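(* Let $w=w_1\cdots w_n$ be a Christoffel word of length $n$ over $\{a,b\}$, and let $w=uv$ be its palindromic factorization, with cut position $c=|u|$. Fix $k$ with $0\le k\le n$. Let $f_1,f_2,\ldots,f_r$ be the words $w_{s+1}\cdots w_{s+k}$ for the integers $s$ with $0\le s\le n-k$ and $s\le c\le s+k$, listed in increasing order of $s$ (factors of length $k$ meeting the cut, ordered from left to right). Let $g_1,g_2,\ldots,g_{r'}$ be the words $w_{t+1}\cdots w_{t+n-k}$ for the integers $t$ with $0\le t\le k$ and $t\le c\le t+n-k$, listed in decreasing order of $t$ (factors of length $n-k$ meeting the cut, ordered from right to left). Then $r=r'$, the words $f_1,\ldots,f_r$ are pairwise distinct, the words $g_1,\ldots,g_r$ are pairwise distinct, and the map $f_i\mapsto g_i$ is a bijection from the set of all factors of length $k$ of $w$ onto the set of all factors of length $n-k$ of $w$ satisfying $\gamma(f_i)+\gamma(g_i)=\gamma(w)$ for every $i$.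
   Context: Words are finite words over $\{a,b\}$; a factor of $w$ is a contiguous subword (including the empty word). The Parikh image of a word $x$ is $\gamma(x)=(|x|_a,|x|_b)$. A palindrome is a word equal to its reversal (the empty word is a palindrome). A Christoffel word is either $a$, or $b$, or a word $w=amb$ or $w=bma$ with $m$ a palindrome and $w$ a product of two palindromes. The palindromic factorization of a Christoffel word $w$ is a factorization $w=uv$ with $u$ and $v$ palindromes; for $|w|\ge2$ it is unique (for $|w|=1$ either of the two such factorizations may be taken). *)

(* Defs.v *)
From mathcomp Require Import all_boot all_order all_algebra.
From mathcomp Require Import classical_sets functions.

Set Implicit Arguments.
Unset Strict Implicit.
Unset Printing Implicit Defensive.

Local Open Scope classical_set_scope.
Local Open Scope nat_scope.

Definition word := seq bool.

Definition a : bool := false.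
Definition b : bool := true.

Definition palindrome (x : word) : Prop := rev x = x.

Definition palindromic_factorization (w u v : word) : Prop :=
  [/\ w = u ++ v, palindrome u & palindrome v].

Definition christoffel (w : word) : Prop :=
  [\/ w = [:: a],
      w = [:: b]
    | exists m : word,
        [/\ w = a :: rcons m b \/ w = b :: rcons m a,
            palindrome m
          & exists u v : word, palindromic_factorization w u v]].

Definition parikh (x : word) : nat * nat := (count_mem a x, count_mem b x).

Definition factors (w : word) (l : nat) : set word :=
  [set x | infix x w /\ size x = l].

(* The start positions s, in increasing order, of the occurrences of length l
   that meet the cut c in a word of length n. Both inequalities are non-strict: an
   occurrence ending or starting exactly at the cut meets it. *)
Definition cut_positions (n c l : nat) : seq nat :=
  [seq s <- iota 0 (n - l).+1 | s <= c <= s + l].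

Definition cut_factors (w : word) (c l : nat) : seq word :=
  [seq take l (drop s w) | s <- cut_positions (size w) c l].

(* Main.v *)
Require Import Defs.
From mathcomp Require Import all_boot all_order all_algebra.
From mathcomp Require Import classical_sets functions.
From mathcomp Require Import zify.

(** Index [w] by [Z/n] and let [c] be the cut.  The palindromes [u], [v] say
    that [w] is invariant under [i |-> c - 1 - i]; the central palindrome says
    that it is invariant under [i |-> - 1 - i] except at [0] and [-1], where the
    letters differ.

    Complements: the reflection carries [[c - s, c - s + n - k)] to
    [[s + k, s + n)], the cyclic complement of [[s, s + k)], so the factors of
    lengths [k] and [n - k] starting at [s] and [c - s] have complementary Parikh
    images.

    Distinctness: if two positions at distance [d > 0] meeting the cut carry the
    same factor, then [w_(c-1) = w_(c-1+d)] and [w_(c-d) = w_c]; reflecting gives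
    [w_0 = w_(-d)] and [w_(d-1) = w_(-1)], which contradicts the symmetry of the
    central palindrome.

    Exhaustiveness: composing the two reflections, [w_(i-c) = w_i] unless
    [i = c - 1] or [i = c].  Hence a factor that misses the cut also occurs [c]
    places earlier, cyclically, and its occurrence does not wrap around.  Since
    [w_c <> w_0], the orbit of [0] under this rotation must go through [c - 1], so
    [c] is invertible modulo [n]: the rotation is transitive on positions, and
    iterating it reaches an occurrence meeting the cut. *)

Set Implicit Arguments.
Unset Strict Implicit.
Unset Printing Implicit Defensive.

Local Open Scope classical_set_scope.
Local Open Scope nat_scope.

Lemma palindrome_nth (x : word) (i : nat) :
  palindrome x -> i < size x -> nth a x i = nth a x (size x - i.+1).
Proof. by move=> px ltix; rewrite -{1}px nth_rev. Qed.

Lemma palindrome_drop (x : word) (i : nat) :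
  palindrome x -> drop i x = rev (take (size x - i) x).
Proof. by move=> px; rewrite -{1}px drop_rev. Qed.

Lemma mem_cut_positions (n c l s : nat) :
  (s \in cut_positions n c l) = [&& s <= c, c <= s + l & s <= n - l].
Proof. by rewrite mem_filter mem_iota add0n ltnS -andbA. Qed.

(** Under [t = c - s], the bounds [s <= n - k] and [c <= s + k] turn into [c <= t + (n - k)] and
    [t <= k]; both lists are strictly decreasing. *)
Lemma rev_cut_positions (n c k : nat) : c <= n -> k <= n ->
  rev (cut_positions n c (n - k)) = [seq c - s | s <- cut_positions n c k].
Proof.
move=> lecn lekn; apply: (@sorted_eq _ (fun x y => y < x)).
- by move=> y x z /= lxy lyz; apply: ltn_trans lyz lxy.
- by move=> x y /andP[]; lia.
- by rewrite rev_sorted sorted_filter ?iota_ltn_sorted //; apply: ltn_trans.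
- rewrite sorted_map.
  have: sorted ltn (cut_positions n c k).
    by rewrite sorted_filter ?iota_ltn_sorted //; apply: ltn_trans.
  apply: (@sub_in_sorted _ [pred s | s <= c]) => [s t|].
    by rewrite !inE /=; lia.
  by apply/allP => s; rewrite mem_cut_positions => /and3P[].
- apply: uniq_perm.
  + by rewrite rev_uniq filter_uniq ?iota_uniq.
  + rewrite map_inj_in_uniq ?filter_uniq ?iota_uniq // => s t.
    by rewrite !mem_cut_positions; lia.
  + move=> t; rewrite mem_rev mem_cut_positions; apply/idP/mapP.
      by move=> ?; exists (c - t); rewrite ?mem_cut_positions; lia.
    by case=> s; rewrite mem_cut_positions => ? ->; lia.
Qed.

Lemma rev_cut_factors (w : word) (c k : nat) : c <= size w -> k <= size w ->
  rev (cut_factors w c (size w - k)) =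
  [seq take (size w - k) (drop (c - s) w) | s <- cut_positions (size w) c k].
Proof.
by move=> lecn lekn; rewrite /cut_factors -map_rev rev_cut_positions // -map_comp.
Qed.

Lemma count_complementary (p : pred bool) (w u v : word) (k s : nat) :
  palindromic_factorization w u v -> k <= size w ->
  s \in cut_positions (size w) (size u) k ->
  count p (take k (drop s w))
    + count p (take (size w - k) (drop (size u - s) w)) = count p w.
Proof.
case=> -> pu pv; rewrite size_cat mem_cut_positions => lek hs.
rewrite !drop_cat.
have take_across (i l : nat) : i <= size u <= i + l ->
    take l (drop i (u ++ v)) = drop i u ++ take (l - (size u - i)) v.
  move=> hi; rewrite drop_cat; case: ltnP => [lti|lei].
    by rewrite take_cat size_drop ifF //; lia.
  have -> : i = size u by lia.
  by rewrite drop_size subnn drop0 subn0.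
rewrite -!drop_cat !take_across; [|lia|lia].
rewrite (palindrome_drop (size u - s) pu).
(* [r] letters of [v] lie in the window at [s]; the other window consists of the reversals of
   [take s u] and [drop r v]. *)
set r := k - _.
have -> : take (size u + size v - k - (size u - (size u - s))) v = rev (drop r v).
  by rewrite (palindrome_drop r pv) revK /r; congr take; lia.
have -> : size u - (size u - s) = s by lia.
rewrite !count_cat !count_rev -{3}(cat_take_drop s u) -{3}(cat_take_drop r v).
rewrite !count_cat; lia.
Qed.

Lemma christoffel_cases (w : word) : christoffel w ->
  size w = 1 \/
  [/\ 1 < size w, nth a w 0 <> nth a w (size w).-1
    & forall i, 0 < i < (size w).-1 -> nth a w i = nth a w ((size w).-1 - i)].
Proof.
case=> [-> | -> | [m [hw pm _]]]; [by left | by left | right].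
have [x [y [-> nxy]]] : exists x y, w = x :: rcons m y /\ x <> y.
  by case: hw => ->; [exists a, b | exists b, a].
rewrite /= size_rcons /= nth_rcons ltnn eqxx; split=> // -[//|i] hi.
rewrite subSS -[nth _ _ i.+1]/(nth a (rcons m y) i).
have -> : (size m - i) = (size m - i.+1).+1 by lia.
rewrite /= !nth_rcons !ifT; [|lia|lia].
by apply: palindrome_nth => //; lia.
Qed.

Lemma infix_position (w x : word) :
  infix x w -> exists2 s, s <= size w - size x & x = take (size x) (drop s w).
Proof.
case/infixP=> p [t ->]; exists (size p); last by rewrite drop_size_cat ?take_size_cat.
by rewrite !size_cat addnCA addKn leq_addr.
Qed.

Lemma size_window (w : word) (k s : nat) :
  s + k <= size w -> size (take k (drop s w)) = k.
Proof. by move=> hs; rewrite size_takel // size_drop; lia. Qed.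

Lemma eq_window (w : word) (k s t : nat) : s + k <= size w -> t + k <= size w ->
  take k (drop s w) = take k (drop t w) <->
  forall i, i < k -> nth a w (s + i) = nth a w (t + i).
Proof.
move=> hs ht; split=> [e i ltik|e].
  by rewrite -!nth_drop -(nth_take a ltik) e nth_take.
apply: (@eq_from_nth _ a) => [|i].
  by rewrite !size_window.
rewrite size_window // => ltik.
by rewrite !nth_take // !nth_drop e.
Qed.

(** * Christoffel words of length at least two *)

Section ProperChristoffel.

Variables w u v : word.
Hypothesis huv : palindromic_factorization w u v.
Hypothesis n_gt1 : 1 < size w.
Hypothesis ends_neq : nth a w 0 <> nth a w (size w).-1.
Hypothesis central : forall i, 0 < i < (size w).-1 ->
  nth a w i = nth a w ((size w).-1 - i).

Local Notation n := (size w).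
Local Notation c := (size u).
Local Notation q := (size v).

Let size_w : n = c + q.
Proof. by case: huv => -> _ _; rewrite size_cat. Qed.

Let nth_u (i : nat) : i < c -> nth a w i = nth a w (c - i.+1).
Proof.
case: huv => -> pu _ lti; rewrite !nth_cat !ifT; [|lia|lia].
exact: palindrome_nth.
Qed.

Let nth_v (i : nat) : c <= i < n -> nth a w i = nth a w (n + c - i.+1).
Proof.
rewrite size_w; case: huv => -> _ pv hi; rewrite !nth_cat !ifF; [|lia|lia].
by rewrite palindrome_nth; [congr nth; lia| |lia].
Qed.

(** Otherwise [w = v] is a palindrome and its two ends agree. *)
Let c_gt0 : 0 < c.
Proof.
case: (posnP c) => // c0; case: ends_neq.
by rewrite nth_v ?c0; [congr nth; lia|lia].
Qed.

Let q_gt0 : 0 < q.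
Proof.
case: (posnP q) => // q0; case: ends_neq.
by rewrite nth_u; [congr nth; lia|lia].
Qed.

(** The first letter of [v] is also its last, hence the last letter of [w]. *)
Let nth_c_neq : nth a w c <> nth a w 0.
Proof.
move=> e; apply: ends_neq; rewrite -e nth_v; last lia.
by congr nth; lia.
Qed.

(* [- c] modulo [n] is written [+ q], to avoid truncated subtraction. *)
Lemma nth_rotation (i : nat) : i < n -> i != c -> i != c.-1 ->
  nth a w ((i + q) %% n) = nth a w i.
Proof.
move=> ltin neq_c neq_c1; case: (ltnP i c) => hi.
  rewrite modn_small; last lia.
  rewrite (nth_u hi) central; last lia.
  by congr nth; lia.
have -> : i + q = n + (i - c) by lia.
rewrite modnDl modn_small; last lia.
rewrite [RHS]nth_v; last lia.
by rewrite central; [congr nth; lia|lia].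
Qed.

(** As [n.-1] is [-1] modulo [n], this makes [q] invertible; [n.-1] comes one step after [c.-1]. *)
Lemma rotation_generates_pred : exists j, j * q = n.-1 %[mod n].
Proof.
have /orP[/existsP[j /eqP hj]|/existsPn noj] :=
  orbN [exists j : 'I_n, (j * q) %% n == c.-1].
  exists j.+1; rewrite mulSn addnC -modnDml hj; congr (_ %% _); lia.
(* As long as the orbit of [0] avoids [c.-1], it keeps its letter, and so avoids [c] as well. *)
have const (j : nat) : j < n -> nth a w ((j * q) %% n) = nth a w 0.
  elim: j => [|j IHj] ltjn; first by rewrite mul0n mod0n.
  have ltmn : (j * q) %% n < n by rewrite ltn_mod; lia.
  rewrite mulSn addnC -modnDml nth_rotation ?IHj //; try lia.
    by apply/eqP => e; apply: nth_c_neq; rewrite -e IHj //; lia.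
  exact: noj (Ordinal (ltnW ltjn)).
(* [n.-1] steps of [q] amount to [- q], which is [c] modulo [n]. *)
case: nth_c_neq; rewrite -(const n.-1); last lia.
have -> : n.-1 * q = q.-1 * n + c by nia.
by rewrite modnMDl modn_small //; lia.
Qed.

Lemma rotation_transitive (s t : nat) : t < n -> exists j, (s + j * q) %% n = t.
Proof.
move=> lttn; have [j hj] := rotation_generates_pred.
(* Since [j * q] is [-1] modulo [n], this multiple subtracts [s - t]; the added [n] avoids
   truncation. *)
exists ((s + n - t) * j); rewrite -mulnA -modnDmr -modnMmr hj modnMmr modnDmr.
have -> : s + (s + n - t) * n.-1 = (s + n - t).-1 * n + t by nia.
by rewrite modnMDl modn_small.
Qed.

(** Meeting the cut is non-strict, so a window that misses it contains neither [c.-1] nor [c], and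
    [nth_rotation] applies to all its letters. *)
Lemma shift_factor (k s : nat) : k <= n -> s < n -> s <= n - k ->
  s \notin cut_positions n c k ->
  (s + q) %% n <= n - k /\
  take k (drop ((s + q) %% n) w) = take k (drop s w).
Proof.
move=> lekn lt_sn lesn; rewrite mem_cut_positions => nmeet.
have shift_le : (s + q) %% n <= n - k.
  case: (ltnP s c) => hs; first by rewrite modn_small; lia.
  have -> : s + q = n + (s - c) by lia.
  by rewrite modnDl modn_small; lia.
split=> //; apply/eq_window; [lia|lia|move=> i ltik].
rewrite -(@nth_rotation (s + i)); [|lia|lia|lia].
by congr nth; rewrite addnAC -[RHS]modnDml [RHS]modn_small //; lia.
Qed.

Lemma position_meeting_cut (k s : nat) : k <= n -> s <= n - k ->
  exists2 t, t \in cut_positions n c k & take k (drop t w) = take k (drop s w).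
Proof.
move=> lekn lesn.
(* The target is the rightmost position meeting the cut; the number of steps to it bounds the number
   of shifts. *)
have [j hj] : exists j, (s + j * q) %% n = minn c (n - k).
  by apply: rotation_transitive; lia.
(* [s = n] is not a residue modulo [n]; it occurs only for the empty factor. *)
have [ltsn|lesn'] := ltnP s n; last first.
  have k0 : k = 0 by lia.
  by exists c; [rewrite mem_cut_positions; lia|rewrite k0 !take0].
rewrite -(modn_small ltsn) in lesn *.
elim: j s hj {ltsn} lesn => [|j IHj] s hj lesn.
  exists (s %% n) => //; rewrite mem_cut_positions.
  by move: hj; rewrite mul0n addn0; lia.
have [meet|nmeet] := boolP (s %% n \in cut_positions n c k); first by exists (s %% n).
have [|le' <-] := shift_factor lekn _ lesn nmeet; first by rewrite ltn_mod; lia.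
rewrite modnDml in le' *; apply: IHj => //.
by rewrite -addnA -mulSn.
Qed.

(** * Distinctness of the factors meeting the cut *)

Lemma uniq_cut_factors_proper (k : nat) : k <= n -> uniq (cut_factors w c k).
Proof.
move=> lekn; rewrite map_inj_in_uniq ?filter_uniq ?iota_uniq //.
suff lt_neq s t : s < t -> s \in cut_positions n c k ->
    t \in cut_positions n c k -> take k (drop s w) <> take k (drop t w).
  move=> s t hs ht e; case: (ltngtP s t) => // lt_st.
    by case: (lt_neq _ _ lt_st hs ht).
  by case: (lt_neq _ _ lt_st ht hs).
move=> lt_st; rewrite !mem_cut_positions => hs ht /eq_window e.
have {}e i : s <= i < s + k -> nth a w i = nth a w (i + (t - s)).
  move=> hi; have := e _ _ (i - s); rewrite subnKC; last lia.
  by move=> ->; [congr nth; lia|lia|lia|lia].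
have := e c.-1; have := e (c - (t - s)); set d := t - s in e *.
rewrite subnK; last lia.
move=> e1 e2; have {}e1 := e1 ltac:(lia); have {}e2 := e2 ltac:(lia).
have h0 : nth a w c.-1 = nth a w 0 by rewrite nth_u; [congr nth; lia|lia].
rewrite h0 (@nth_v (c.-1 + d)) in e2; last lia.
rewrite (@nth_u (c - d)) in e1; last lia.
have e3 : c - (c - d).+1 = d.-1 by lia.
have e4 : n + c - (c.-1 + d).+1 = n - d by lia.
rewrite e3 in e1; rewrite e4 in e2.
(* For [d = 1], [central] does not cover [d.-1 = 0], but [e1] alone is then the contradiction. *)
have [d1|d_gt1] := leqP d 1.
  by apply: nth_c_neq; rewrite -e1; congr nth; lia.
apply: nth_c_neq; rewrite -e1 e2 central; last lia.
by congr nth; lia.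
Qed.

End ProperChristoffel.

Lemma uniq_cut_factors (w u v : word) (k : nat) :
  christoffel w -> palindromic_factorization w u v -> k <= size w ->
  uniq (cut_factors w (size u) k).
Proof.
move=> hw huv lekn.
case: (christoffel_cases hw) => [n1|[n_gt1 ends central]]; last first.
  exact: uniq_cut_factors_proper huv n_gt1 ends central k lekn.
(* In length one, a single position meets the cut. *)
rewrite map_inj_in_uniq ?filter_uniq ?iota_uniq // => s t.
by rewrite !mem_cut_positions; lia.
Qed.

Lemma set_cut_factors (w u v : word) (k : nat) :
  christoffel w -> palindromic_factorization w u v -> k <= size w ->
  [set` cut_factors w (size u) k] = factors w k.
Proof.
move=> hw huv lekn; apply/seteqP; split=> x /=.
  case/mapP=> s; rewrite mem_cut_positions => hs ->; split.
    exact: infix_trans (infix_take _ _) (infix_drop _ _).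
  by apply: size_window; lia.
case=> /infix_position[s]; move=> + + szx; rewrite szx => les ->.
suff [t ht <-] : exists2 t, t \in cut_positions (size w) (size u) k
    & take k (drop t w) = take k (drop s w) by exact: map_f.
case: (christoffel_cases hw) => [n1|[n_gt1 ends central]]; last first.
  exact: position_meeting_cut huv n_gt1 ends central _ _ lekn les.
have lecn : size u <= size w by case: huv => -> _ _; rewrite size_cat leq_addr.
have [k0|k_gt0] := posnP k.
  by exists (size u); [rewrite mem_cut_positions; lia|rewrite k0 !take0].
by exists s; rewrite // mem_cut_positions; lia.
Qed.

Theorem theorem4 (w u v : word) (k : nat)
    (hw : christoffel w)
    (huv : palindromic_factorization w u v)
    (hk : k <= size w) :
  let n := size w in
  let c := size u in
  let f := cut_factors w c k in
  let g := rev (cut_factors w c (n - k)) in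
  [/\ size f = size g,
      uniq f,
      uniq g,
      [set` f] = factors w k
    & exists phi : word -> word,
        [/\ forall i, i < size f -> phi (nth [::] f i) = nth [::] g i,
            set_bij (factors w k) (factors w (n - k)) phi
          & forall i, i < size f ->
              (parikh (nth [::] f i) + parikh (nth [::] g i))%R = parikh w]].
Proof.
move=> n c f g.
have lecn : c <= n by rewrite /n; case: huv => -> _ _; rewrite size_cat leq_addr.
have gE := rev_cut_factors lecn hk; rewrite -/n -/g in gE.
have sz_fg : size f = size g by rewrite gE !size_map.
have uniq_f : uniq f by exact: uniq_cut_factors hw huv hk.
have uniq_g : uniq g.
  by rewrite rev_uniq; apply: uniq_cut_factors hw huv (leq_subr _ _).
have set_f : [set` f] = factors w k by exact: set_cut_factors hw huv hk.
have set_g : [set` g] = factors w (n - k).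
  rewrite -(set_cut_factors hw huv (leq_subr k n)).
  by apply/seteqP; split=> x /=; rewrite mem_rev.
split=> //; exists (fun x => nth [::] g (index x f)); split.
- by move=> i lti; rewrite index_uniq.
- rewrite -set_f -set_g; split.
  + by move=> x /= xf; rewrite mem_nth // -sz_fg index_mem.
  + move=> x y; rewrite !inE /= => xf yf /eqP.
    rewrite nth_uniq -?sz_fg ?index_mem // => /eqP e.
    by rewrite -(nth_index [::] xf) e nth_index.
  + move=> y /= yg; exists (nth [::] f (index y g)).
      by rewrite /= mem_nth // sz_fg index_mem.
    by rewrite index_uniq ?nth_index // sz_fg index_mem.
- move=> i; rewrite size_map => lti.
  rewrite gE !(nth_map 0) //.
  have hs := mem_nth 0 lti.
  rewrite /parikh -(count_complementary (pred1 a) huv hk hs).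
  by rewrite -(count_complementary (pred1 b) huv hk hs).
Qed.
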